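(* Let $n$ be a positive integer and let $L$ be a finite-dimensional supersolvable Lie algebra over a field $F$. Suppose that either $F$ has characteristic zero, or $F$ has characteristic $p>0$ and $L$ has no nilpotent subideal of nilpotency class greater than or equal to $p-1$. Then every $n$-maximal subalgebra of $L$ is a subideal of $L$ if and only if either (i) $L$ is nilpotent; or (ii) $\dim L\leq n$.
   Context: An $n$-maximal subalgebra of $L$ is a subalgebra $S_0$ for which there is a chain $S_0<S_1<\cdots<S_n=L$ of subalgebras with each $S_i$ a maximal subalgebra of $S_{i+1}$. A subideal of $L$ is a subalgebra $I$ for which there is a chain $I=I_0\subseteq I_1\subseteq\cdots\subseteq I_k=L$ of subalgebras with each $I_j$ an ideal of $I_{j+1}$. $L$ is supersolvable if it has a chain of ideals of $L$ from $0$ to $L$ whose successive quotients are one-dimensional. *)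

(* Defs.v *)
From HB Require Import structures.
From mathcomp Require Import all_boot all_order all_algebra.

Set Implicit Arguments.
Unset Strict Implicit.
Unset Printing Implicit Defensive.

Import GRing.Theory.
Local Open Scope ring_scope.

HB.mixin Record Vector_isLie (F : fieldType) (L : Type) of Vector F L := {
  lie : L -> L -> L;
  lie_linearl : forall z : L, linear (lie^~ z);
  lie_linearr : forall z : L, linear (lie z);
  liexx : forall x : L, lie x x = 0;
  lie_jacobi : forall x y z : L,
    lie x (lie y z) + lie y (lie z x) + lie z (lie x y) = 0
}.

#[short(type="lieAlgType")]
HB.structure Definition LieAlgebra (F : fieldType) :=
  {L of Vector F L & Vector_isLie F L}.

Section LieSubspaces.
Variables (F : fieldType) (L : lieAlgType F).
Implicit Types (I S T U V W : {vspace L}) (c : nat -> {vspace L}).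

HB.instance Definition _ (z : L) :=
  GRing.isLinear.Build F L L _ (lie z) (lie_linearr z).

(* [U, V] is the span of all brackets of an element of U with an element of V;
   by bilinearity, bases of U and V suffice (see lieprod_subP). *)
Definition lieprod U V : {vspace L} :=
  <<[seq lie u v | u <- vbasis U, v <- vbasis V]>>%VS.

Lemma lieprod_subP U V W :
  reflect (forall u v, u \in U -> v \in V -> lie u v \in W)
          (lieprod U V <= W)%VS.
Proof.
apply: (iffP span_subvP) => [sUVW u v Uu Vv | sUVW w].
  rewrite (coord_vbasis Vv) linear_sum memv_suml // => j _.
  rewrite linearZ memvZ //=.
  pose f := linfun (GRing.Linear.clone _ _ _ _ (lie^~ (vbasis V)`_j)
    (HB.pack (lie^~ (vbasis V)`_j)
      (GRing.isLinear.Build F L L _ _ (lie_linearl (vbasis V)`_j)))).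
  have fE x : f x = lie x (vbasis V)`_j by rewrite lfunE.
  rewrite -fE (coord_vbasis Uu) linear_sum memv_suml // => i _.
  rewrite linearZ memvZ //= fE.
  by apply: sUVW; apply: allpairs_f; apply: mem_nth; rewrite size_tuple.
by case/allpairsP=> -[u v] [/= /vbasis_mem Uu /vbasis_mem Vv ->]; apply: sUVW.
Qed.

Definition subalgebra U : bool := (lieprod U U <= U)%VS.

Definition ideal_of I U : bool := (I <= U)%VS && (lieprod U I <= I)%VS.

Definition maximal_subalgebra_of S T : Prop :=
  [/\ subalgebra S, (S <= T)%VS, S != T &
      forall U, subalgebra U -> (S <= U)%VS -> (U <= T)%VS -> U = S \/ U = T].

(* Chains of length n are maps c on nat of which only c 0, ..., c n matter. *)
Definition n_maximal_subalgebra n S : Prop :=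
  exists c, [/\ c 0%N = S, c n = fullv,
    forall i, (i <= n)%N -> subalgebra (c i) &
    forall i, (i < n)%N -> maximal_subalgebra_of (c i) (c i.+1)].

Definition subideal I : Prop :=
  exists k c, [/\ c 0%N = I, c k = fullv,
    forall i, (i <= k)%N -> subalgebra (c i) &
    forall i, (i < k)%N -> ideal_of (c i) (c i.+1)].

(* The lower central series, indexed from 0: U, [U, U], [U, [U, U]], ... *)
Fixpoint lower_central U k : {vspace L} :=
  if k is j.+1 then lieprod U (lower_central U j) else U.

Definition lie_nilpotent U : Prop := exists k, lower_central U k = 0%VS.

(* U is nilpotent of class k: the zero algebra has class 0, and a nonzero
   abelian one has class 1. *)
Definition lie_nilpotent_of_class U k : Prop :=
  lower_central U k = 0%VS /\
  forall j, (j < k)%N -> lower_central U j <> 0%VS.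

End LieSubspaces.

Definition supersolvable (F : fieldType) (L : lieAlgType F) : Prop :=
  exists k (c : nat -> {vspace L}), [/\ c 0%N = 0%VS, c k = fullv,
    forall i, (i <= k)%N -> ideal_of (c i) fullv &
    forall i, (i < k)%N ->
      (c i <= c i.+1)%VS /\ (\dim (c i.+1) - \dim (c i) = 1)%N].

(* Main.v *)
(** In a supersolvable algebra, adding to [S] the traces on [T] of a flag of
    ideals inserts between subalgebras [S <= T] a subalgebra of each
    intermediate dimension; hence every subalgebra of codimension [n] is
    [n]-maximal.  If [L] is not nilpotent, the flag yields [x] with [ad x] not
    nilpotent.  The Fitting null component of [ad x] is a proper subalgebra, so
    it lies in a subalgebra [M] of codimension 1.  When [n < dim L], choose [S]
    of codimension [n] with [x] in [S <= M].  If [S] were a subideal, it would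
    contain the image of a power of [ad x], and so [M] would contain both
    Fitting components of [ad x], that is, all of [L]. *)
Require Import Defs.
From HB Require Import structures.
From mathcomp Require Import all_boot all_order all_algebra.

Set Implicit Arguments.
Unset Strict Implicit.
Unset Printing Implicit Defensive.

Import GRing.Theory.
Local Open Scope ring_scope.

Section LieAlgebra.
Variables (F : fieldType) (L : lieAlgType F).
Implicit Types (x y z : L) (S T U V I : {vspace L}).

(** * Bracket identities and elementary subalgebras *)

Lemma lieDl x y z : lie (x + y) z = lie x z + lie y z.
Proof. by have := lie_linearl z 1 x y; rewrite /= !scale1r. Qed.

Lemma lieDr x y z : lie x (y + z) = lie x y + lie x z.
Proof. exact: linearD. Qed.

Lemma lieC x y : lie x y = - lie y x.
Proof.
apply/eqP; rewrite -addr_eq0; apply/eqP.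
by have := liexx (x + y); rewrite lieDl !lieDr !liexx add0r addr0.
Qed.

Lemma lie_derivation x y z : lie x (lie y z) = lie (lie x y) z + lie y (lie x z).
Proof.
have := lie_jacobi x y z; rewrite [lie z x]lieC linearN /= [lie z _]lieC.
by move/eqP; rewrite subr_eq0 subr_eq addrC => /eqP ->; rewrite addrC.
Qed.

Lemma memv_lieprod U V u v : u \in U -> v \in V -> lie u v \in lieprod U V.
Proof. by move=> Uu Vv; apply: (lieprod_subP _ _ _ (subvv _)). Qed.

(** The condition is that [S] normalises [I]: the lemma is applied to traces [c i :&: T] of ideals,
    which are normalised by [S <= T] but may fail to be ideals of [L]. *)
Lemma subalgebra_addv_ideal S I :
  subalgebra S -> (lieprod S I <= I)%VS -> (lieprod I I <= I)%VS ->
  subalgebra (S + I)%VS.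
Proof.
move=> /lieprod_subP sS /lieprod_subP sSI /lieprod_subP sI.
apply/lieprod_subP=> _ _ /memv_addP[s Ss [a Ia ->]] /memv_addP[t St [b Ib ->]].
have aT: lie a t \in I by rewrite lieC rpredN sSI.
rewrite lieDl !lieDr -addrA memv_add ?sS //.
by apply: rpredD; [exact: sSI | apply: rpredD; [|exact: sI]].
Qed.

Lemma subalgebra0 : subalgebra (0%VS : {vspace L}).
Proof.
apply/lieprod_subP=> u v; rewrite !memv0 => /eqP-> _.
by rewrite lieC linear0 oppr0.
Qed.

Lemma subalgebra_fullv : subalgebra (fullv : {vspace L}).
Proof. exact: subvf. Qed.

Lemma subalgebra_capv S T : subalgebra S -> subalgebra T -> subalgebra (S :&: T)%VS.
Proof.
move=> /lieprod_subP sS /lieprod_subP sT; apply/lieprod_subP=> u v.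
by rewrite !memv_cap => /andP[? ?] /andP[? ?]; rewrite sS ?sT.
Qed.

Lemma subalgebra_vline x : subalgebra <[x]>%VS.
Proof.
apply/lieprod_subP=> _ _ /vlineP[a ->] /vlineP[b ->].
by rewrite linearZ /= lieC linearZ /= liexx scaler0 oppr0 scaler0 mem0v.
Qed.

Lemma subideal0 : subideal (0%VS : {vspace L}).
Proof.
exists 1%N, (fun i => if i is 0%N then 0%VS else fullv).
split=> // [[|i] _|[|//] _] /=; rewrite ?subalgebra0 ?subalgebra_fullv //.
rewrite /ideal_of sub0v; apply/lieprod_subP=> u v _.
by rewrite memv0 => /eqP->; rewrite linear0 mem0v.
Qed.

(** * Powers of [ad x] and the Fitting decomposition *)

Section AdjointPowers.
Variable x : L.

Lemma iter_lie_is_linear m : linear (iter m (lie x)).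
Proof. by elim: m => [|m IHm] a u v //=; rewrite IHm linearP. Qed.

HB.instance Definition _ m :=
  GRing.isLinear.Build F L L _ (iter m (lie x)) (iter_lie_is_linear m).

Definition ad_pow m : 'End(L) := linfun (iter m (lie x)).

Lemma ad_powE m y : ad_pow m y = iter m (lie x) y.
Proof. by rewrite lfunE. Qed.

Lemma memv_lker_ad_pow m y : (y \in lker (ad_pow m)) = (iter m (lie x) y == 0).
Proof. by rewrite memv_ker ad_powE. Qed.

Lemma lker_ad_powS m : (lker (ad_pow m) <= lker (ad_pow m.+1))%VS.
Proof.
apply/subvP=> y; rewrite !memv_lker_ad_pow /= => /eqP->.
by rewrite linear0.
Qed.

(** By the Leibniz rule the left side is a combination of brackets of [iter i (lie x) y] with
    [iter j (lie x) z], [i + j = m + n], and then [i >= m] or [j >= n]. The induction, on a bound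
    for [m + n], applies the derivation rule once per step. *)
Lemma iter_lie_lie_eq0 m n y z : iter m (lie x) y = 0 -> iter n (lie x) z = 0 ->
  iter (m + n) (lie x) (lie y z) = 0.
Proof.
move: {2}(m + n)%N (leqnn (m + n)) => s; elim: s => [|s IHs] in m n y z *.
  rewrite leqn0 addn_eq0 => /andP[/eqP-> /eqP->] /= -> _.
  by rewrite lieC linear0 oppr0.
case: m => [|m]; first by move=> _ /= -> _; rewrite lieC linear0 oppr0 linear0.
case: n => [|n]; first by move=> _ _ /= ->; rewrite !linear0.
rewrite addSn ltnS => le_mns y0 z0; rewrite iterSr lie_derivation linearD /=.
by rewrite IHs -?iterSr // -addSnnS IHs -?iterSr ?addr0 // addSnnS.
Qed.

Lemma lker_ad_pow_stable :
  exists m, forall k, (lker (ad_pow k) <= lker (ad_pow m))%VS.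
Proof.
(* Once two consecutive kernels coincide, the chain is constant from there on. *)
suff [m eq_m]: exists m, (lker (ad_pow m.+1) <= lker (ad_pow m))%VS.
  exists m => k; apply/subvP=> y; rewrite !memv_lker_ad_pow => /eqP y0.
  have: iter (k + m) (lie x) y == 0 by rewrite addnC iterD y0 linear0.
  elim: k {y0} => // k IHk; rewrite addSnnS addnC iterD => yk; apply: IHk.
  rewrite addnC iterD -memv_lker_ad_pow; apply: (subvP eq_m).
  by rewrite memv_lker_ad_pow.
(* Induction on a bound [d] for the codimension of the kernel, which drops as long as the chain
   grows strictly. *)
suff /(_ _ 0%N (leqnn _)): forall d m, (\dim {:L} - \dim (lker (ad_pow m)) <= d)%N ->
    exists m, (lker (ad_pow m.+1) <= lker (ad_pow m))%VS by [].
elim=> [|d IHd] m le_d.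
  exists m; rewrite (_ : lker (ad_pow m) = fullv) ?subvf //.
  by apply/eqP; rewrite eqEdim subvf -subn_eq0 -leqn0.
have [|/negPf ker_lt] := boolP (lker (ad_pow m.+1) <= lker (ad_pow m))%VS.
  by exists m.
apply: (IHd m.+1); rewrite -ltnS (leq_trans _ le_d) // ltn_sub2l //.
  rewrite (leq_trans _ (dimvS (subvf (lker (ad_pow m.+1))))) //.
  by rewrite (ltn_leqif (dimv_leqif_sup (lker_ad_powS m))) ker_lt.
by rewrite (ltn_leqif (dimv_leqif_sup (lker_ad_powS m))) ker_lt.
Qed.

Lemma subalgebra_lker_ad_pow m :
  (forall k, (lker (ad_pow k) <= lker (ad_pow m))%VS) ->
  subalgebra (lker (ad_pow m)).
Proof.
move=> stab_m; apply/lieprod_subP=> y z; rewrite !memv_lker_ad_pow.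
move=> /eqP y0 /eqP z0; rewrite -memv_lker_ad_pow.
apply: (subvP (stab_m (m + m)%N)).
by rewrite memv_lker_ad_pow (iter_lie_lie_eq0 y0 z0).
Qed.

(** If [iter k (lie x) y] is killed by the [m]-th power, then [y] lies in the stable kernel, so the
    vector is already 0 as [m <= k]. The sum is thus direct, and rank-nullity makes it all of
    [L]. *)
Lemma fitting m k : (forall j, (lker (ad_pow j) <= lker (ad_pow m))%VS) ->
  (m <= k)%N -> (lker (ad_pow m) + limg (ad_pow k))%VS = fullv.
Proof.
move=> stab_m le_mk; apply/eqP.
have capI: (lker (ad_pow m) :&: limg (ad_pow k) = 0)%VS.
  apply/eqP; rewrite -subv0; apply/subvP=> z /memv_capP[ker_z /memv_imgP[y _ def_z]].
  move: ker_z; rewrite {}def_z ad_powE memv_lker_ad_pow -iterD => ker_y.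
  have: y \in lker (ad_pow m).
    by apply: (subvP (stab_m (m + k)%N)); rewrite memv_lker_ad_pow.
  rewrite memv_lker_ad_pow memv0 -(subnK le_mk) iterD => /eqP->.
  by rewrite linear0.
rewrite eqEdim subvf /= dimv_disjoint_sum //.
rewrite -(limg_ker_dim (ad_pow k) fullv) capfv leq_add2r.
apply: dimvS; exact: stab_m.
Qed.

(* Each bracket with [x] descends one step in the chain of a subideal. *)
Lemma subideal_ad_pow I : subideal I -> x \in I ->
  exists k, forall j, (k <= j)%N -> (limg (ad_pow j) <= I)%VS.
Proof.
case=> k [c [c0 ck c_sub c_ideal]] Ix; exists k => j le_kj.
have xc i : (i <= k)%N -> x \in c i.
  elim: i => [|i IHi] lt_ik; first by rewrite c0.
  by case/andP: (c_ideal i lt_ik) => /subvP sub_c _; apply/sub_c/IHi/ltnW.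
have descend i y : (i <= k)%N -> y \in c i -> iter i (lie x) y \in I.
  elim: i y => [|i IHi] y lt_ik yc; first by rewrite -c0.
  rewrite iterSr; apply: IHi; first exact: ltnW.
  case/andP: (c_ideal i lt_ik) => _ /lieprod_subP c_lie.
  by rewrite lieC rpredN; apply: c_lie => //; apply/xc/ltnW.
apply/subvP=> _ /memv_imgP[y _ ->]; rewrite ad_powE -(subnKC le_kj) iterD.
by apply: descend; rewrite // ck memvf.
Qed.

End AdjointPowers.

(** * Subalgebras of nilpotent Lie algebras *)

Lemma nilpotent_subideal S :
  lie_nilpotent (fullv : {vspace L}) -> subalgebra S -> subideal S.
Proof.
case=> k lck0 sS; pose lc := lower_central (fullv : {vspace L}).
have lc_ideal j : (lieprod fullv (lc j) <= lc j)%VS.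
  elim: j => [|j IHj]; first exact: subvf.
  apply/lieprod_subP=> u v _ v_lc; apply: memv_lieprod; rewrite ?memvf //.
  by apply: (subvP IHj).
have lcS j : (lc j.+1 <= lc j)%VS := lc_ideal j.
have sub_lc j : subalgebra (S + lc j)%VS.
  by apply: subalgebra_addv_ideal => //;
    apply/lieprod_subP=> u v _ v_lc; apply: (subvP (lc_ideal j));
    apply: memv_lieprod; rewrite ?memvf.
(* The index is reversed so that the chain climbs from [S + lc k = S] to [S + lc 0 = L]. Each term
   is an ideal of the next because [[L, lc j]] is [lc j.+1]. *)
exists k, (fun i => S + lc (k - i)%N)%VS; split=> //.
- by rewrite subn0 [lc k]lck0 addv0.
- by rewrite subnn; apply/eqP; rewrite eqEsubv subvf addvSr.
move=> i lt_ik; rewrite -(subnSK lt_ik); move: (k - i.+1)%N => j.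
rewrite /ideal_of addvS //=; apply/lieprod_subP.
move=> _ _ /memv_addP[s Ss [a a_lc ->]] /memv_addP[t St [b b_lc ->]].
have a_lie y : lie a y \in lc j.+1.
  by rewrite lieC rpredN memv_lieprod ?memvf.
rewrite lieDl !lieDr -addrA memv_add //; first exact: (lieprod_subP _ _ _ sS).
apply: rpredD; last exact: rpredD.
apply: (subvP (lc_ideal j.+1)); exact: memv_lieprod (memvf _) b_lc.
Qed.

Lemma addv_vline_codim1 U V v : (U <= V)%VS -> (\dim V - \dim U = 1)%N ->
  v \in V -> v \notin U -> (<[v]> + U)%VS = V.
Proof.
move=> sUV dimUV Vv vNU; apply/eqP.
rewrite eqEdim subv_add sUV -memvE Vv /= -(subnK (dimvS sUV)) dimUV add1n.
by rewrite (ltn_leqif (dimv_leqif_sup (addvSr _ _))) subv_add subvv andbT -memvE.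
Qed.

(** * Consequences of a flag of ideals *)

Section Supersolvable.
Hypothesis Lsuper : supersolvable L.

(** A discrete intermediate value argument: the dimension of [S + (c i :&: T)] starts at [\dim S],
    ends at [\dim T] and rises by at most one per step. *)
Lemma subalgebra_of_dim S T m : subalgebra S -> subalgebra T -> (S <= T)%VS ->
  (\dim S <= m <= \dim T)%N ->
  exists U, [/\ subalgebra U, (S <= U)%VS, (U <= T)%VS & \dim U = m].
Proof.
case: Lsuper => k [c [c0 ck c_ideal c_step]] sS sT sST.
pose U i := (S + (c i :&: T))%VS.
have sub_U i : (i <= k)%N -> subalgebra (U i).
  move=> le_ik; case/andP: (c_ideal i le_ik) => _ /lieprod_subP ci.
  have sI : subalgebra (c i :&: T)%VS.
    apply: subalgebra_capv => //; apply/lieprod_subP=> u v _.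
    exact: ci (memvf _).
  apply: subalgebra_addv_ideal => //.
  apply/lieprod_subP=> u v Su; rewrite !memv_cap => /andP[vc vT].
  rewrite ci ?memvf //=; apply: (lieprod_subP _ _ _ sT) => //.
  exact: (subvP sST).
have dimU i : (i < k)%N -> (\dim (U i.+1) <= (\dim (U i)).+1)%N.
  move=> lt_ik; have [sub_c dim_c] := c_step i lt_ik.
  have [sub_cT|/subvPn[v]] := boolP (c i.+1 :&: T <= c i)%VS.
    apply: leqW; apply: dimvS; apply: addvS => //.
    by rewrite subv_cap sub_cT capvSr.
  rewrite memv_cap => /andP[vc vT] vNc.
  have def_c := addv_vline_codim1 sub_c dim_c vc vNc.
  (* Since [v] lies in [T], the modular law turns [(<[v]> + c i) :&: T] into [<[v]> + (c i :&: T)]: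
     the trace gains a single line. *)
  rewrite /U -def_c -vspace_modl -?memvE // addvA [(S + _)%VS]addvC -addvA.
  rewrite (leq_trans (dimv_add_leqif _ _)) // dim_vline -add1n leq_add2r.
  by case: (v != 0).
case/andP=> leSm lemT.
suff [i [le_ik dim_Ui]]: exists i, (i <= k)%N /\ \dim (U i) = m.
  exists (U i); split=> //; rewrite ?sub_U ?addvSl //.
  by rewrite subv_add sST capvSr.
have leU0 : (\dim (U 0%N) <= m)%N by rewrite /U c0 cap0v addv0.
have : (m <= \dim (U k))%N by rewrite /U ck capfv (addv_idPr sST).
suff search i : (i <= k)%N -> (m <= \dim (U i))%N ->
  exists i, (i <= k)%N /\ \dim (U i) = m by exact: search.
elim: i => [|i IHi] le_ik leU.
  by exists 0%N; split=> //; apply/eqP; rewrite eqn_leq leU0.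
have [leUi|ltUi] := leqP m (\dim (U i)).
  by apply: IHi => //; apply: ltnW.
exists i.+1; split=> //; apply/eqP; rewrite eqn_leq leU andbT.
exact: leq_trans (dimU i le_ik) ltUi.
Qed.

Lemma maximal_subalgebra_codim1 S T : subalgebra S -> (S <= T)%VS ->
  \dim T = (\dim S).+1 -> maximal_subalgebra_of S T.
Proof.
move=> sS sST dimT; split=> //.
  by apply: contra_eq_neq dimT => ->; rewrite ltn_eqF.
move=> U _ sSU sUT; have [leUS|ltSU] := leqP (\dim U) (\dim S).
  by left; apply/eqP; rewrite eq_sym eqEdim sSU.
by right; apply/eqP; rewrite eqEdim sUT dimT.
Qed.

Lemma n_maximal_codim n S : subalgebra S -> \dim {:L} = (\dim S + n)%N ->
  n_maximal_subalgebra n S.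
Proof.
elim: n S => [|n IHn] S sS dimL.
  exists (fun=> fullv); split=> //; last by move=> i _; exact: subalgebra_fullv.
    by apply/eqP; rewrite eq_sym eqEdim subvf dimL addn0 /=.
have [|U [sU sSU _ dimU]] :=
    subalgebra_of_dim (m := (\dim S).+1) sS subalgebra_fullv (subvf S).
  by rewrite leqnSn dimL addnS ltnS leq_addr.
have [|c [c0 cn c_sub c_max]] := IHn U sU; first by rewrite dimU dimL addnS.
(* The chain of the larger subalgebra [U] is shifted by one, with [S] put in front. *)
exists (fun i => if i is j.+1 then c j else S); split=> // [[|i]|[|i]] //.
- exact: c_sub.
- by rewrite c0 => _; apply: maximal_subalgebra_codim1.
- exact: c_max.
Qed.

Lemma ad_nilpotent_of_n_maximal n x : (0 < n)%N -> (n < \dim {:L})%N ->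
  (forall S, n_maximal_subalgebra n S -> subideal S) ->
  exists m, forall y, iter m (lie x) y = 0.
Proof.
move=> n_gt0 lt_nL nmax; have [m stab_m] := lker_ad_pow_stable x.
have [keq|kneq] := eqVneq (lker (ad_pow x m)) fullv.
  by exists m => y; apply/eqP; rewrite -memv_lker_ad_pow keq memvf.
have dimK : (\dim (lker (ad_pow x m)) < \dim {:L})%N.
  by rewrite ltnNge; apply: contra kneq => ?; rewrite eqEdim subvf.
have [|M [sM sKM _ dimM]] := subalgebra_of_dim (m := (\dim {:L}).-1)
    (subalgebra_lker_ad_pow stab_m) subalgebra_fullv (subvf _).
  by rewrite leq_pred andbT -ltnS (ltn_predK dimK).
have Mx : (<[x]> <= M)%VS.
  rewrite -memvE; apply: (subvP sKM); apply: (subvP (stab_m 1%N)).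
  by rewrite memv_lker_ad_pow /= liexx.
(* The target dimension lies between [\dim <[x]> <= 1], as [n < \dim L], and [\dim M = \dim L - 1],
   as [n > 0]. *)
have [|S [sS sxS sSM dimS]] := subalgebra_of_dim (m := \dim {:L} - n)
    (subalgebra_vline x) sM Mx.
  rewrite dimM dim_vline -subn1 leq_sub2l // andbT.
  by rewrite (leq_trans (leq_b1 _)) // subn_gt0.
have subS : subideal S.
  by apply/nmax/n_maximal_codim => //; rewrite dimS subnK // ltnW.
have [k imS] : exists k, forall j, (k <= j)%N -> (limg (ad_pow x j) <= S)%VS.
  by apply: subideal_ad_pow; rewrite ?memvE.
have : (fullv <= M)%VS.
  (* The exponent [maxn m k] is large enough both for the Fitting decomposition and for the image to
     lie in [S]. *)
  rewrite -(fitting stab_m (leq_maxl m k)) subv_add sKM.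
  exact: subv_trans (imS _ (leq_maxr m k)) sSM.
move/dimvS; rewrite dimM -ltnS (ltn_predK dimK).
by rewrite ltnn.
Qed.

(** On a one-dimensional quotient of the flag [ad x] acts as a scalar, which is 0 by nilpotency.
    Hence [L] maps each flag term into the previous one, and the lower central series descends along
    the flag. *)
Lemma nilpotent_of_ad_nilpotent :
  (forall x, exists m, forall y, iter m (lie x) y = 0) ->
  lie_nilpotent (fullv : {vspace L}).
Proof.
case: Lsuper => k [c [c0 ck c_ideal c_step]] ad_nil; exists k.
have step i : (i < k)%N -> (lieprod fullv (c i.+1) <= c i)%VS.
  move=> lt_ik; have [sub_c dim_c] := c_step i lt_ik.
  case/andP: (c_ideal i.+1 lt_ik) => _ /lieprod_subP ci1.
  case/andP: (c_ideal i (ltnW lt_ik)) => _ /lieprod_subP ci.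
  apply/lieprod_subP=> x v _ vc.
  have [|vNc] := boolP (v \in c i); first exact: ci (memvf _).
  have def_c := addv_vline_codim1 sub_c dim_c vc vNc.
  have: lie x v \in c i.+1 by apply: ci1; rewrite ?memvf.
  rewrite -def_c => /memv_addP[_ /vlineP[a ->] [w wc def_xv]].
  have [m nil_x] := ad_nil x.
  (* Modulo [c i], [ad x] multiplies [v] by [a], so its [j]-th power multiplies [v] by [a ^+ j]. *)
  have pow j : iter j (lie x) v - a ^+ j *: v \in c i.
    elim: j => [|j IHj]; first by rewrite expr0 scale1r subrr mem0v.
    have := ci x _ (memvf x) IHj; rewrite linearB linearZ /= def_xv => memj.
    rewrite exprSr -scalerA -[_ - _](subrK (a ^+ j *: w)).
    by rewrite rpredD ?rpredZ // -addrA -opprD -scalerDr.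
  have := pow m; rewrite nil_x sub0r rpredN => av.
  have [a0|a_neq0] := eqVneq a 0.
    by rewrite def_xv a0 scale0r add0r.
  case/negP: vNc; rewrite -[v]scale1r -(mulVf (expf_neq0 m a_neq0)) -scalerA.
  exact: rpredZ.
suff lc_c i : (i <= k)%N -> (lower_central fullv i <= c (k - i)%N)%VS.
  by apply/eqP; rewrite -subv0 -c0 -(subnn k) lc_c.
elim: i => [|i IHi] lt_ik; first by rewrite subn0 ck.
have lt_sub : (k - i.+1 < k)%N by rewrite ltn_subrL (leq_ltn_trans _ lt_ik).
apply/lieprod_subP=> x v Lx v_lc; apply: (subvP (step _ lt_sub)).
apply: memv_lieprod => //; rewrite subnSK //.
exact: (subvP (IHi (ltnW lt_ik))).
Qed.

End Supersolvable.

(** * Dimension bound and the equivalence *)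

Lemma n_maximal_dim n S : n_maximal_subalgebra n S -> (\dim S + n <= \dim {:L})%N.
Proof.
case=> c [<- <- _ c_max]; elim: n c_max => [|n IHn] c_max; first by rewrite addn0.
have [_ sc neq _] := c_max n (ltnSn n).
(* The last inclusion of the chain is strict, so it adds at least one dimension. *)
rewrite addnS; apply: leq_ltn_trans (IHn _) _ => [i lt_in|].
  by apply: c_max; apply: ltnW.
by rewrite (ltn_leqif (dimv_leqif_eq sc)).
Qed.

End LieAlgebra.

Theorem theorem4p3 (n : nat) (F : fieldType) (L : lieAlgType F)
    (n_gt0 : (0 < n)%N) (Lsupersolvable : supersolvable L)
    (charF : [pchar F] =i pred0 \/
      exists2 p : nat, p \in [pchar F] &
        ~ (exists (I : {vspace L}) (k : nat),
             [/\ subideal I, lie_nilpotent_of_class I k & (p - 1 <= k)%N])) :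
  (forall S : {vspace L}, n_maximal_subalgebra n S -> subideal S) <->
  (lie_nilpotent (fullv : {vspace L}) \/ (\dim (fullv : {vspace L}) <= n)%N).
Proof.
split=> [nmax|[Lnil|dimL] S Smax].
- have [dimL|lt_nL] := leqP (\dim {:L}) n; [by right | left].
  apply: nilpotent_of_ad_nilpotent => // x.
  exact: ad_nilpotent_of_n_maximal nmax.
- apply: nilpotent_subideal => //.
  by case: Smax => c [<- _ c_sub _]; apply: c_sub.
have dimS : \dim S == 0%N.
  have /leq_trans/(_ dimL) := n_maximal_dim Smax.
  by rewrite -[X in (_ <= X)%N]add0n leq_add2r leqn0.
by move: dimS; rewrite dimv_eq0 => /eqP->; apply: subideal0.
Qed.
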